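(* Let $n,k,h,i$ be integers with $0<k<n$ and $h\geq 2$, and suppose that $\mathcal{F}_h^i(k,n)$ is non-empty. Then the $i$th ordered configuration space $\mathcal{F}_h^i(k,n)$ is a complex submanifold of $Gr(k,n)^h$ of (complex) dimension $$d_h^i(k,n)=i(n-i)+hk(i-k).$$
   Context: $Gr(k,n)$ is the complex Grassmannian manifold parametrizing the $k$-dimensional linear subspaces of $\mathbb{C}^n$, with $0<k<n$, and $Gr(k,n)^h$ is its $h$-fold Cartesian product. For a manifold $M$, $\mathcal{F}_h(M)=\{(x_1,\ldots,x_h)\in M^h\mid x_a\neq x_b \text{ for } a\neq b\}$ is the ordered configuration space of $h$ distinct points in $M$. The $i$th ordered configuration space is $$\mathcal{F}_h^i(k,n)=\{(H_1,\ldots,H_h)\in\mathcal{F}_h(Gr(k,n))\mid \dim(H_1+\cdots+H_h)=i\}.$$ Submanifold means locally closed (embedded) complex submanifold, not necessarily closed. *)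

(* Defs.v *)
From HB Require Import structures.
From mathcomp Require Import all_boot all_order all_algebra.
From mathcomp Require Import complex.
From mathcomp Require Import all_classical all_reals all_analysis.

Set Implicit Arguments.
Unset Strict Implicit.
Unset Printing Implicit Defensive.
Import Order.TTheory GRing.Theory Num.Theory.
Import numFieldNormedType.Exports.
Local Open Scope classical_set_scope.
Local Open Scope ring_scope.

(* The type R[i] itself does not inherit the norm topology of MathComp-Analysis;
   the same field, seen as a numClosedFieldType, does. *)
Definition complexes (R : realType) : numClosedFieldType := R[i]%C.

Section Differentiability.
Variables (K : numFieldType) (V : normedModType K).

Lemma differentiable_near (W : normedModType K) (f g : V -> W) (x : V) :
  (\forall y \near x, f y = g y) -> differentiable g x -> differentiable f x.
Proof.
move=> fg dg; have [cg eg] := (diff_locallyP x g).1 dg.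
have fgx : f x = g x by exact: nbhs_singleton fg.
have ef : f \o shift x = cst (f x) + 'd g x +o_ 0 id.
  move: (fg); rewrite (near_shift 0) subr0 => fg0.
  apply/eqaddoP => e e0; have /eqaddoP/(_ e e0) := eg.
  by apply: filterS2 fg0 => h /= fgh; rewrite !fctE /= fgh fgx.
have ed : 'd f x = 'd g x :> (V -> W) by exact: diff_unique.
by apply/diff_locallyP; rewrite ed.
Qed.

Lemma open_neq0 : open [set z : K | z != 0].
Proof.
rewrite (_ : [set z | _] = ~` [set 0]); last first.
  by apply/seteqP; split=> z /= /eqP.
by rewrite openC; apply: accessible_closed_set1; apply: hausdorff_accessible; exact: norm_hausdorff.
Qed.

Lemma differentiable_bigsum (I : Type) (r : seq I) (P : pred I)
    (W : normedModType K) (f : I -> V -> W) (x : V) :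
  (forall i, differentiable (f i) x) ->
  differentiable (fun y => \sum_(i <- r | P i) f i y) x.
Proof.
move=> df; elim: r => [|i r IH].
  under eq_fun do rewrite big_nil; exact: differentiable_cst.
under eq_fun do rewrite big_cons; case: (P i) => //.
exact: (@differentiableD _ _ _ (f i) _ x).
Qed.

Lemma differentiable_bigprod (I : Type) (r : seq I) (P : pred I)
    (f : I -> V -> K) (x : V) :
  (forall i, differentiable (f i) x) ->
  differentiable (fun y => \prod_(i <- r | P i) f i y) x.
Proof.
move=> df; elim: r => [|i r IH].
  under eq_fun do rewrite big_nil; exact: differentiable_cst.
under eq_fun do rewrite big_cons; case: (P i) => //.
exact: (@differentiableM _ _ (f i) _ x).
Qed.

Lemma differentiable_mx p q (F : V -> 'M[K]_(p, q)) (x : V) :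
  (forall i j, differentiable (fun y => F y i j) x) -> differentiable F x.
Proof.
move=> dF.
have -> : F = fun y => \sum_i \sum_j F y i j *: delta_mx i j.
  by apply/funext => y; exact: matrix_sum_delta.
do 2 apply: differentiable_bigsum => ?.
exact: differentiableZl.
Qed.

Lemma differentiable_entry p q (F : V -> 'M[K]_(p, q)) (x : V) i j :
  differentiable F x -> differentiable (fun y => F y i j) x.
Proof.
move=> dF; apply: (@differentiable_comp _ _ _ _ F (fun M => M i j)) => //.
exact: differentiable_coord.
Qed.

Lemma differentiable_det p (F : V -> 'M[K]_p) (x : V) :
  differentiable F x -> differentiable (fun y => \det (F y)) x.
Proof.
move=> dF; apply: differentiable_bigsum => s.
apply: differentiableM; first exact: differentiable_cst.
by apply: differentiable_bigprod => i; exact: differentiable_entry.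
Qed.

Lemma differentiable_mulmx p q r (F : V -> 'M[K]_(p, q)) (G : V -> 'M[K]_(q, r))
    (x : V) :
  differentiable F x -> differentiable G x ->
  differentiable (fun y => F y *m G y) x.
Proof.
move=> dF dG; apply: differentiable_mx => i j.
under eq_fun do rewrite mxE; apply: differentiable_bigsum => l.
by apply: differentiableM; exact: differentiable_entry.
Qed.

Lemma differentiable_invmx p (F : V -> 'M[K]_p) (x : V) :
  differentiable F x -> F x \in unitmx ->
  differentiable (fun y => invmx (F y)) x.
Proof.
move=> dF Fx.
have dD := differentiable_det dF.
have D0 : \det (F x) != 0 by rewrite -unitfE.
apply: (@differentiable_near _ _ (fun y => (\det (F y))^-1 *: \adj (F y))).
  have cD := differentiable_continuous dD.
  have : \forall y \near x, \det (F y) != 0.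
    exact: (cD _ (open_nbhs_nbhs (conj open_neq0 D0))).
  apply: filterS => y /= Dy.
  by rewrite /invmx unitmxE unitfE Dy.
apply: differentiable_mx => i j.
under eq_fun do rewrite !mxE.
apply: differentiableM; first exact: differentiableV.
apply: differentiableM; first exact: differentiable_cst.
apply: differentiable_det; apply: differentiable_mx => a b.
by under eq_fun do rewrite !mxE; exact: differentiable_entry.
Qed.

End Differentiability.

Section ComplexManifolds.
Variable C : numClosedFieldType.

(* [differentiable] is Frechet differentiability over the base field C of the
   normed module, i.e. complex differentiability. *)
Definition holomorphic_on p q (D : set 'rV[C]_p) (f : 'rV[C]_p -> 'rV[C]_q) :=
  open D /\ forall z, D z -> differentiable f z.

Record chart (M : Type) (m : nat) := Chart {
  chart_dom : set M ;
  chart_map : M -> 'rV[C]_m ;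
  chart_inv : 'rV[C]_m -> M ;
  chart_mapK : forall p, chart_dom p -> chart_inv (chart_map p) = p ;
  chart_open : open (chart_map @` chart_dom) }.

Section Charts.
Variables (M : Type) (m : nat).
Implicit Types c : chart M m.

(* chart_map c' \o chart_inv c is the change of coordinates; its domain is the
   image under c of the overlap of c and c'. *)
Definition holo_transition c c' :=
  holomorphic_on (chart_map c @` (chart_dom c `&` chart_dom c'))
                 (chart_map c' \o chart_inv c).

Definition compatible c c' := holo_transition c c' /\ holo_transition c' c.

Record holo_atlas := HoloAtlas {
  atlas_charts : set (chart M m) ;
  atlas_cover : forall p, exists2 c, atlas_charts c & chart_dom c p ;
  atlas_compat : forall c c', atlas_charts c -> atlas_charts c' ->
    compatible c c' }.

(* Slice charts: around each point of S there is a chart c of the complex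
   structure defined by the atlas which maps the points of S in its domain onto
   the points of its image in C^d x {0}. The domains of such charts are open
   and S is closed in their union, so that S is locally closed. *)
Definition is_submanifold (A : holo_atlas) (d : nat) (S : set M) :=
  (d <= m)%N /\
  forall p, S p -> exists c : chart M m,
    [/\ forall c', atlas_charts A c' -> compatible c' c,
        chart_dom c p &
        forall q, chart_dom c q ->
          (S q <-> forall j : 'I_m, (d <= j)%N -> chart_map c q 0 j = 0)].

End Charts.

Section Product.
Variables (M : Type) (m h : nat).

Section ProductChart.
Variable c : 'I_h -> chart M m.

Definition prod_dom : set ('I_h -> M) :=
  [set x | forall a, chart_dom (c a) (x a)].

Definition prod_map (x : 'I_h -> M) : 'rV[C]_(h * m) :=
  mxvec (\matrix_(a < h) chart_map (c a) (x a)).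

Definition prod_inv (z : 'rV[C]_(h * m)) : 'I_h -> M :=
  fun a => chart_inv (c a) (row a (vec_mx z)).

Lemma prod_mapK x : prod_dom x -> prod_inv (prod_map x) = x.
Proof.
move=> xD; apply/funext => a.
by rewrite /prod_inv /prod_map mxvecK rowK chart_mapK.
Qed.

Lemma open_rows (D : 'I_h -> set 'rV[C]_m) : (forall a, open (D a)) ->
  open [set z : 'rV[C]_(h * m) | forall a, D a (row a (vec_mx z))].
Proof.
move=> oD.
have cr a : continuous (fun z : 'rV[C]_(h * m) => row a (vec_mx z)).
  move=> z; apply: differentiable_continuous; apply: differentiable_mx => i j.
  by under eq_fun do rewrite !mxE; exact: differentiable_coord.
rewrite openE => z zD.
suff : \forall y \near z, forall a, D a (row a (vec_mx y)) by [].
apply: (@filter_forall _ _ (fun a y => D a (row a (vec_mx y))) (nbhs z)) => a.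
have oa : open ((fun z : 'rV[C]_(h * m) => row a (vec_mx z)) @^-1` D a).
  by apply: open_comp => // y _; exact: cr.
exact: (open_nbhs_nbhs (conj oa (zD a))).
Qed.

Lemma prod_map_image (D : 'I_h -> set M) :
  (forall a, D a `<=` chart_dom (c a)) ->
  prod_map @` [set x | forall a, D a (x a)] =
  [set z | forall a, (chart_map (c a) @` D a) (row a (vec_mx z))].
Proof.
move=> sD; apply/seteqP; split=> [_ [x xD <-] a|z zD].
  by exists (x a) => //; rewrite /prod_map mxvecK rowK.
have eqz a : chart_map (c a) (prod_inv z a) = row a (vec_mx z).
  by have [q Dq qz] := zD a; rewrite /prod_inv -qz chart_mapK //; exact: sD.
exists (prod_inv z) => [a|] /=.
  by have [q Dq qz] := zD a; rewrite /prod_inv -qz chart_mapK //; exact: sD.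
rewrite /prod_map -[RHS]vec_mxK; congr mxvec.
by apply/row_matrixP => a; rewrite rowK.
Qed.

Lemma prod_open : open (prod_map @` prod_dom).
Proof.
rewrite (prod_map_image (D := fun a => chart_dom (c a))); last by move=> a; exact: subset_refl.
by apply: (open_rows (D := fun a => chart_map (c a) @` chart_dom (c a))) => a;
  exact: chart_open.
Qed.

Definition prod_chart := Chart prod_mapK prod_open.

End ProductChart.

Variable A : holo_atlas M m.

Definition prod_charts : set (chart ('I_h -> M) (h * m)) :=
  [set prod_chart c | c in [set c | forall a, atlas_charts A (c a)]].

Lemma prod_cover x : exists2 c, prod_charts c & chart_dom c x.
Proof.
have /choice[c cx] : forall a, exists c, atlas_charts A c /\ chart_dom c (x a).
  by move=> a; have [c] := atlas_cover A (x a); exists c.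
exists (prod_chart c); last by move=> a; case: (cx a).
by exists c => //= a; case: (cx a).
Qed.

Lemma prod_compat c c' : prod_charts c -> prod_charts c' -> compatible c c'.
Proof.
suff tr (e e' : 'I_h -> chart M m) : (forall a, atlas_charts A (e a)) ->
    (forall a, atlas_charts A (e' a)) ->
    holo_transition (prod_chart e) (prod_chart e').
  by move=> [e eA <-] [e' e'A <-]; split; exact: tr.
move=> eA e'A; rewrite /holo_transition /= /prod_dom.
rewrite (_ : _ `&` _ =
  [set x | forall a, (chart_dom (e a) `&` chart_dom (e' a)) (x a)]); last first.
  by apply/seteqP; split=> x /= => [[xe xe'] a|xD]; split=> // a; case: (xD a).
rewrite (prod_map_image (D := fun a => chart_dom (e a) `&` chart_dom (e' a)));
  last by move=> a; exact: subIsetl.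
have oe a : holo_transition (e a) (e' a) by exact: (atlas_compat (eA a) (e'A a)).1.
split=> [|z zD].
  by apply: (open_rows (D := fun a => chart_map (e a) @` (_ `&` _))) => a;
    have [] := oe a.
have dr a : differentiable (fun z : 'rV[C]_(h * m) => row a (vec_mx z)) z.
  apply: differentiable_mx => i j.
  by under eq_fun do rewrite !mxE; exact: differentiable_coord.
apply: differentiable_mx => i j; case/mxvec_indexP: j => a b.
rewrite (_ : (fun y => _) = fun y =>
  (chart_map (e' a) \o chart_inv (e a)) (row a (vec_mx y)) 0 b); last first.
  by apply/funext => y; rewrite (ord1 i) mxvecE !mxE.
apply: differentiable_entry.
apply: (@differentiable_comp _ _ _ _ (fun y : 'rV[C]_(h * m) => row a (vec_mx y))).
  exact: dr.
by have [_] := oe a; apply; exact: zD.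
Qed.

Definition prod_atlas : holo_atlas ('I_h -> M) (h * m) :=
  HoloAtlas prod_cover prod_compat.

End Product.
End ComplexManifolds.

Section Grassmannian.
Variables (C : numClosedFieldType) (k n : nat).

Definition Gr := {H : {vspace 'rV[C]_n} | \dim H == k}.

Definition rowspan p (B : 'M[C]_(p, n)) : {vspace 'rV[C]_n} :=
  <<[tuple row a B | a < p]>>%VS.

Lemma mem_rowspan p (B : 'M[C]_(p, n)) v : (v \in rowspan B) = (v <= B)%MS.
Proof.
apply/idP/idP.
  move=> /coord_span ->; apply: summx_sub => a _; apply: scalemx_sub.
  by rewrite nth_mktuple row_sub.
case/submxP => D ->; rewrite mulmx_sum_row; apply: rpred_sum => a _.
by apply: rpredZ; apply: memv_span; apply/tnthP; exists a; rewrite tnth_mktuple.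
Qed.

Lemma eq_rowspan p q (B : 'M[C]_(p, n)) (B' : 'M[C]_(q, n)) :
  (B :=: B')%MS -> rowspan B = rowspan B'.
Proof. by move=> eB; apply/vspaceP => v; rewrite !mem_rowspan eB. Qed.

Lemma rowspan_eq p q (B : 'M[C]_(p, n)) (B' : 'M[C]_(q, n)) :
  rowspan B = rowspan B' -> (B :=: B')%MS.
Proof.
move=> /vspaceP eB; apply/eqmxP/andP; split; apply/row_subP => a.
  by rewrite -mem_rowspan -eB mem_rowspan row_sub.
by rewrite -mem_rowspan eB mem_rowspan row_sub.
Qed.

Lemma dim_rowspan p (B : 'M[C]_(p, n)) : \dim (rowspan B) = \rank B.
Proof.
rewrite -(eq_rowspan (eq_row_base B)); set D := row_base B.
have fD : row_free D by exact: row_base_free.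
suff : free [tuple row a D | a < \rank B].
  by rewrite /free => /eqP ->; rewrite size_tuple.
apply/freeP => c /= c0 a.
have : (\row_b c b) *m D = 0.
  rewrite mulmx_sum_row -[RHS]c0; apply: eq_bigr => b _.
  by rewrite mxE nth_mktuple.
rewrite -(mul0mx _ D) => /(row_free_inj fD)/rowP/(_ a).
by rewrite !mxE.
Qed.

Definition basis_mx (H : Gr) : 'M[C]_(k, n) := \matrix_(a < k) (vbasis (val H))`_a.

Lemma rowspan_basis_mx H : rowspan (basis_mx H) = val H.
Proof.
rewrite -[RHS](span_basis (vbasisP (val H))).
congr span; apply: (@eq_from_nth _ 0).
  by rewrite !size_tuple (eqP (valP H)).
move=> j; rewrite size_tuple => jk.
by rewrite -[j]/(val (Ordinal jk)) nth_mktuple rowK.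
Qed.

Lemma rank_basis_mx H : \rank (basis_mx H) = k.
Proof. by rewrite -dim_rowspan rowspan_basis_mx; exact: (eqP (valP H)). Qed.

Section AffineChart.
(* The bijection e splits the n coordinates into k pivot coordinates, e (inl a),
   and n - k other ones, e (inr b). A subspace whose k x k pivot minors are
   nonzero has a unique basis matrix with pivot block 1; the entries of the
   remaining block are its affine coordinates. *)
Variable e : 'I_k + 'I_(n - k) -> 'I_n.

Definition pivot p (B : 'M[C]_(p, n)) : 'M[C]_(p, k) :=
  colsub (fun a => e (inl a)) B.
Definition copivot p (B : 'M[C]_(p, n)) : 'M[C]_(p, n - k) :=
  colsub (fun b => e (inr b)) B.

Lemma pivotM p q (P : 'M[C]_(p, q)) B : pivot (P *m B) = P *m pivot B.
Proof. by apply/matrixP => a b; rewrite !mxE; apply: eq_bigr => j _; rewrite mxE. Qed.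

Lemma copivotM p q (P : 'M[C]_(p, q)) B : copivot (P *m B) = P *m copivot B.
Proof. by apply/matrixP => a b; rewrite !mxE; apply: eq_bigr => j _; rewrite mxE. Qed.

Variable e' : 'I_n -> 'I_k + 'I_(n - k).
Hypotheses (eK : cancel e e') (e'K : cancel e' e).

(* the k x n matrix with pivot block 1 and copivot block X *)
Definition frame (X : 'M[C]_(k, n - k)) : 'M[C]_(k, n) :=
  \matrix_(a, j) match e' j with inl b => (a == b)%:R | inr b => X a b end.

Lemma pivot_frame X : pivot (frame X) = 1%:M.
Proof. by apply/matrixP => a b; rewrite !mxE eK. Qed.

Lemma copivot_frame X : copivot (frame X) = X.
Proof. by apply/matrixP => a b; rewrite !mxE eK. Qed.

Lemma frameP B : pivot B = 1%:M -> B = frame (copivot B).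
Proof.
move=> B1; apply/matrixP => a j; rewrite mxE -{1}(e'K j).
case: (e' j) => b; last by rewrite mxE.
by move/matrixP/(_ a b): B1; rewrite !mxE.
Qed.

Lemma rank_frame X : \rank (frame X) = k.
Proof.
apply/eqP; rewrite eqn_leq rank_leq_row /=.
have /row_freeP : exists D, frame X *m D = 1%:M.
  exists (\matrix_(j, a) (j == e (inl a))%:R).
  rewrite -(pivot_frame X); apply/matrixP => a b; rewrite !mxE.
  rewrite (bigD1 (e (inl b))) //= big1 ?addr0 => [|j /negPf jb].
    by rewrite !mxE eqxx mulr1.
  by rewrite !mxE jb mulr0.
by rewrite /row_free => /eqP ->.
Qed.

Lemma frame_subproof X : \dim (rowspan (frame X)) == k.
Proof. by rewrite dim_rowspan rank_frame. Qed.

Definition affine_dom : set Gr := [set H | pivot (basis_mx H) \in unitmx].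

Definition affine_map (H : Gr) : 'rV[C]_(k * (n - k)) :=
  mxvec (invmx (pivot (basis_mx H)) *m copivot (basis_mx H)).

Definition affine_inv (z : 'rV[C]_(k * (n - k))) : Gr :=
  Sub (rowspan (frame (vec_mx z))) (frame_subproof (vec_mx z)).

Lemma affine_mapK H : affine_dom H -> affine_inv (affine_map H) = H.
Proof.
move=> uH; apply: val_inj; rewrite /= /affine_map mxvecK.
rewrite -copivotM -frameP; last by rewrite pivotM mulVmx.
by rewrite -[RHS]rowspan_basis_mx; apply: eq_rowspan; apply: eqmxMfull;
  rewrite row_full_unit unitmx_inv.
Qed.

Lemma basis_affine_inv z : exists2 P : 'M[C]_k,
  P \in unitmx & basis_mx (affine_inv z) = P *m frame (vec_mx z).
Proof.
have eB : (basis_mx (affine_inv z) :=: frame (vec_mx z))%MS.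
  by apply: rowspan_eq; rewrite rowspan_basis_mx.
have /submxP[P BP] : (basis_mx (affine_inv z) <= frame (vec_mx z))%MS by rewrite eB.
exists P => //; rewrite -row_free_unit /row_free eqn_leq rank_leq_row /=.
by rewrite -{1}(rank_basis_mx (affine_inv z)) BP mxrankM_maxl.
Qed.

Lemma affine_invD z : affine_dom (affine_inv z).
Proof.
have [P uP BP] := basis_affine_inv z.
by rewrite /affine_dom /= BP pivotM pivot_frame mulmx1.
Qed.

Lemma affine_invK z : affine_map (affine_inv z) = z.
Proof.
have [P uP BP] := basis_affine_inv z.
by rewrite /affine_map BP pivotM copivotM pivot_frame copivot_frame mulmx1
  mulKmx // vec_mxK.
Qed.

Lemma affine_open : open (affine_map @` affine_dom).
Proof.
rewrite (_ : _ @` _ = setT); first exact: openT.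
apply/seteqP; split=> // z _; exists (affine_inv z); last exact: affine_invK.
exact: affine_invD.
Qed.

Definition affine_chart : chart C Gr (k * (n - k)) :=
  Chart affine_mapK affine_open.

End AffineChart.

Definition affine_charts : set (chart C Gr (k * (n - k))) :=
  [set c | exists e e' (eK : cancel e e') (e'K : cancel e' e),
     c = affine_chart eK e'K].

Lemma affine_cover H : exists2 c, affine_charts c & chart_dom c H.
Proof.
have fullB : row_full (basis_mx H)^T by rewrite /row_full mxrank_tr rank_basis_mx.
pose f := fullrankfun fullB.
have f_inj : injective f by exact: fullrankfun_inj.
have cardJ : #|~: [set f a | a : 'I_k]| = (n - k)%N.
  by rewrite cardsCs finset.setCK card_imset // !card_ord.
pose g (b : 'I_(n - k)) : 'I_n := enum_val (cast_ord (esym cardJ) b).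
have gJ b a : g b != f a.
  have : g b \in ~: [set f a | a : 'I_k] by exact: enum_valP.
  by rewrite inE; apply: contraNneq => ->; rewrite imset_f.
pose e (s : 'I_k + 'I_(n - k)) := match s with inl a => f a | inr b => g b end.
have e_inj : injective e.
  move=> [a|b] [a'|b'] /= E.
  - by rewrite (f_inj _ _ E).
  - by have := gJ b' a; rewrite E eqxx.
  - by have := gJ b a'; rewrite E eqxx.
  - by rewrite (cast_ord_inj (enum_val_inj E)).
have lekn : (k <= n)%N by rewrite -(rank_basis_mx H) rank_leq_col.
have [e' eK e'K] : bijective e.
  by apply: inj_card_bij; rewrite // card_sum !card_ord subnKC.
exists (affine_chart eK e'K); first by exists e, e', eK, e'K.
rewrite /= /affine_dom /=.
rewrite -unitmx_tr (_ : _^T = rowsub f (basis_mx H)^T) ?fullrowsub_unit //.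
by apply/matrixP => a b; rewrite !mxE.
Qed.


Lemma affine_compat c c' : affine_charts c -> affine_charts c' -> compatible c c'.
Proof.
suff tr e1 e1' (e1K : cancel e1 e1') (e1'K : cancel e1' e1)
     e2 e2' (e2K : cancel e2 e2') (e2'K : cancel e2' e2) :
    holo_transition (affine_chart e1K e1'K) (affine_chart e2K e2'K).
  by move=> [e1 [e1' [e1K [e1'K ->]]]] [e2 [e2' [e2K [e2'K ->]]]]; split; exact: tr.
pose F (z : 'rV[C]_(k * (n - k))) := frame e1' (vec_mx z).
have dF z : differentiable F z.
  apply: differentiable_mx => a j; rewrite /F.
  under eq_fun do rewrite mxE.
  case: (e1' j) => b; first exact: differentiable_cst.
  by under eq_fun do rewrite mxE; exact: differentiable_coord.
have dp z : differentiable (fun y => pivot e2 (F y)) z.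
  apply: differentiable_mx => a b; under eq_fun do rewrite mxE.
  exact: differentiable_entry.
have dc z : differentiable (fun y => copivot e2 (F y)) z.
  apply: differentiable_mx => a b; under eq_fun do rewrite mxE.
  exact: differentiable_entry.
rewrite /holo_transition /=.
rewrite (_ : _ @` _ = [set z | pivot e2 (F z) \in unitmx]); last first.
  apply/seteqP; split=> [_ [H [H1 H2] <-]|z /= uz].
    have [P uP] := basis_affine_inv e1K (affine_map e1 H).
    rewrite affine_mapK // => BP.
    by move: H2; rewrite /affine_dom /= BP pivotM unitmx_mul uP.
  exists (affine_inv e1K z); last exact: affine_invK.
  split; first exact: affine_invD.
  have [P uP BP] := basis_affine_inv e1K z.
  by rewrite /affine_dom /= BP pivotM unitmx_mul uP.
have oU : open [set z | pivot e2 (F z) \in unitmx].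
  rewrite (_ : [set z | _] = (fun z => \det (pivot e2 (F z))) @^-1` [set x | x != 0]).
    apply: open_comp; last exact: open_neq0.
    by move=> z _; apply: differentiable_continuous; exact: differentiable_det.
  by apply/seteqP; split=> z; rewrite /= unitmxE unitfE.
split=> // z uz.
apply: (@differentiable_near _ _ _ _
  (fun y => mxvec (invmx (pivot e2 (F y)) *m copivot e2 (F y)))).
  have : nbhs z [set z | pivot e2 (F z) \in unitmx] by exact: open_nbhs_nbhs.
  apply: filterS => y /= uy.
  have [P uP BP] := basis_affine_inv e1K y.
  rewrite /affine_map BP pivotM copivotM; congr mxvec.
  by rewrite -[copivot e2 (F y) in LHS](mulKVmx uy) (mulmxA P) mulKmx // unitmx_mul uP.
apply: differentiable_mx => i j; case/mxvec_indexP: j => a b.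
rewrite (_ : (fun y => _) = fun y =>
  (invmx (pivot e2 (F y)) *m copivot e2 (F y)) a b); last first.
  by apply/funext => y; rewrite (ord1 i) mxvecE.
apply: differentiable_entry; apply: differentiable_mulmx => //.
exact: differentiable_invmx.
Qed.

Definition Gr_atlas : holo_atlas C Gr (k * (n - k)) :=
  HoloAtlas affine_cover affine_compat.

End Grassmannian.

Definition configuration_space (h : nat) (M : Type) : set ('I_h -> M) :=
  [set x | forall a b, a <> b -> x a <> x b].

Definition ith_configuration_space (C : numClosedFieldType) (h i k n : nat) :
    set ('I_h -> Gr C k n) :=
  [set H | configuration_space H /\ \dim (\sum_(a < h) val (H a))%VS = i].
Arguments ith_configuration_space C h i k n : clear implicits.

(* Main.v *)
Require Import Defs.
From mathcomp Require Import all_boot all_order all_algebra.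
From mathcomp Require Import all_fingroup.
From mathcomp Require Import complex.
From mathcomp Require Import all_classical all_reals all_analysis.
Local Open Scope classical_set_scope.

(** Near a point H of the stratum, the stratum is the graph of a holomorphic
    function in suitable affine charts of the Grassmannians; a shear
    straightens the graph into a coordinate subspace.

    Let W be the sum of the H_a, a space of dimension i. Choose i coordinates
    of C^n, the image of [g], on which W projects isomorphically. Every H_a
    lies in W, so it still projects injectively on these coordinates, and k
    pivot coordinates of H_a can be found among them ([adapted_pivots]). This
    is the point of the construction: in the resulting product chart, H is
    recorded by hk basis vectors in C^n, the rows of its frames, and outside
    the image of [g] all their entries are free coordinates. Choose finally i
    of the hk rows, indexed by [f], that form a basis of W.

    For nearby configurations the i x i minor on the rows of [f] and the columns
    of [g] stays invertible, hence the selected rows still span an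
    i-dimensional space, and the sum has dimension i exactly when every other
    row lies in that span. A row of the span is determined by its entries in the
    columns of [g]. So the condition says that the entries on the other
    hk - i rows and the other n - i columns are the prescribed rational
    functions of the remaining coordinates ([dim_sum_frames]), one equation
    for each of (hk - i)(n - i) distinct coordinates ([card_dependent_set]).
    The dimension is therefore
      hk(n - k) - (hk - i)(n - i) = i(n - i) + hk(i - k).
    Distinctness of the H_a is an open condition ([open_distinct_frames]), so
    it only shrinks the domain of the chart.

    Subtracting the rational functions from the dependent coordinates gives the
    slice chart; [is_submanifold_shear] isolates this last, purely analytic
    step. *)

Set Implicit Arguments.
Unset Strict Implicit.
Unset Printing Implicit Defensive.
Import Order.TTheory GRing.Theory Num.Theory.
Import numFieldNormedType.Exports.

(** * Composing a chart with a biholomorphism *)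
Section ChangeOfCoordinates.
Local Open Scope ring_scope.

Lemma open_setI_preimage (T U : topologicalType) (D : set T) (E : set U)
    (f : T -> U) :
  open D -> open E -> (forall x, D x -> {for x, continuous f}) ->
  open (D `&` f @^-1` E).
Proof.
move=> oD oE cf; rewrite openE => x [Dx Efx]; apply: filterI.
  exact: open_nbhs_nbhs.
by apply: (cf x Dx); exact: open_nbhs_nbhs.
Qed.

Variables (C : numClosedFieldType) (M : Type) (m : nat) (c : chart C M m).
Variables (U : set 'rV[C]_m) (f g : 'rV[C]_m -> 'rV[C]_m).
Hypotheses (sUc : U `<=` chart_map c @` chart_dom c) (oU : open U).
Hypotheses (fK : forall z, U z -> g (f z) = z) (oV : open (f @` U)).
Hypotheses (df : forall z, U z -> differentiable f z).
Hypotheses (dg : forall z, (f @` U) z -> differentiable g z).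

Let dom := chart_dom c `&` chart_map c @^-1` U.

Let image_dom : (f \o chart_map c) @` dom = f @` U.
Proof.
apply/seteqP; split=> [_ [p [_ Up] <-]|_ [z Uz <-]]; first by exists (chart_map c p).
by have [p cp pz] := sUc Uz; exists p; rewrite /= ?pz //; split=> //=; rewrite pz.
Qed.

Let mapK p : dom p -> (chart_inv c \o g) ((f \o chart_map c) p) = p.
Proof. by move=> [cp Up]; rewrite /= fK // chart_mapK. Qed.

Let open_image_dom : open ((f \o chart_map c) @` dom).
Proof. by rewrite image_dom. Qed.

Definition change_chart : chart C M m := Chart mapK open_image_dom.

(** Both changes of coordinates between c' and the new chart factor through
    those between c' and c, followed or preceded by [f] or [g]; their domains
    are preimages, under maps continuous there, of open sets. *)
Lemma change_chart_compatible c' : compatible c' c -> compatible c' change_chart.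
Proof.
move=> [[oc'c dc'c] [occ' dcc']]; split; split; rewrite /change_chart /=.
- rewrite (_ : _ @` _ = chart_map c' @` (chart_dom c' `&` chart_dom c) `&`
    (chart_map c \o chart_inv c') @^-1` U); last first.
    apply/seteqP; split=> [_ [p [c'p [cp Up]] <-]|_ [[p [c'p cp] <-]]] /=.
      by split; [exists p | rewrite /= chart_mapK].
    by rewrite chart_mapK // => Up; exists p.
  apply: open_setI_preimage => // z zD.
  exact: differentiable_continuous (dc'c z zD).
- move=> _ [p [c'p [cp Up]] <-].
  apply: (@differentiable_comp _ _ _ _ (chart_map c \o chart_inv c')).
    by apply: dc'c; exists p.
  by apply: df; rewrite /= chart_mapK.
- rewrite (_ : _ @` _ = f @` U `&`
    g @^-1` (chart_map c @` (chart_dom c `&` chart_dom c'))); last first.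
    apply/seteqP; split=> [_ [p [[cp Up] c'p] <-]|_ [[z Uz <-]]] /=.
      by split; [exists (chart_map c p) | rewrite /= fK //; exists p].
    rewrite fK // => -[p [cp c'p] pz].
    by exists p; rewrite /= ?pz //; split=> //; split=> //=; rewrite pz.
  apply: open_setI_preimage => // z zD.
  exact: differentiable_continuous (dg zD).
- move=> _ [p [[cp Up] c'p] <-].
  apply: (@differentiable_comp _ _ _ _ g (chart_map c' \o chart_inv c)).
    by apply: dg; exists (chart_map c p).
  by apply: dcc'; rewrite /= fK //; exists p.
Qed.

End ChangeOfCoordinates.

(** * Graphs are submanifolds *)
Section Shear.
Local Open Scope ring_scope.

(** Slice charts kill the last m - d coordinates, whereas the dependent
    coordinates of a graph can be anywhere; this permutation reconciles the two. *)
Lemma perm_to_tail (m d : nat) (T : {set 'I_m}) : #|T| = (m - d)%N -> (d <= m)%N ->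
  exists s : {perm 'I_m}, forall j : 'I_m, (s j \in T) = (d <= j)%N.
Proof.
move=> cT ledm; pose t := enum (~: T) ++ enum T.
have cTc : size (enum (~: T)) = d.
  by rewrite -cardE cardsCs finset.setCK card_ord cT subKn.
have st : size t = m by rewrite size_cat cTc -cardE cT subnKC.
have ut : uniq t.
  rewrite cat_uniq !enum_uniq andbT /=; apply/hasPn => j.
  by rewrite !mem_enum inE => ->.
pose s0 (j : 'I_m) := nth j t j.
have s0_inj : injective s0.
  move=> j j' E; apply/val_inj/eqP; rewrite -(nth_uniq j _ _ ut) ?st ?ltn_ord //.
  by rewrite [nth j t j'](set_nth_default j') ?st ?ltn_ord //; apply/eqP.
exists (perm s0_inj) => j; rewrite permE /s0 nth_cat cTc ltnNge.
case: leqP => dj /=.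
  by rewrite -mem_enum mem_nth // -cardE cT ltn_sub2r // (leq_ltn_trans dj).
by apply/negbTE; rewrite -finset.in_setC -mem_enum mem_nth // cTc.
Qed.

Variables (C : numClosedFieldType) (M : Type) (m : nat).

(** If S is locally given by equations z_j = sh_j(z) for j in T, where sh does
    not involve the coordinates in T, then subtracting sh from the coordinates
    in T is a bijection, with inverse the addition of sh, and it straightens S.
    U is the domain of the chart and V a possibly larger set where sh is
    differentiable; only V is required to be invariant under changes of the
    coordinates in T, so that U may carry open conditions that involve them. *)
Lemma is_submanifold_shear (A : holo_atlas C M m) (d : nat) (S : set M) :
  (d <= m)%N ->
  (forall p, S p -> exists (c : chart C M m) (U V : set 'rV[C]_m)
      (T : {set 'I_m}) (sh : 'rV[C]_m -> 'rV[C]_m),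
    [/\ [/\ atlas_charts A c, chart_map c @` chart_dom c = setT,
            chart_dom c p & U (chart_map c p)],
        [/\ #|T| = (m - d)%N, open V, open U & U `<=` V],
        (forall z, V z -> differentiable sh z),
        [/\ (forall (z : 'rV[C]_m) j, j \notin T -> sh z 0 j = 0),
            (forall z z' : 'rV[C]_m, (forall j, j \notin T -> z 0 j = z' 0 j) -> sh z = sh z') &
            (forall z z' : 'rV[C]_m, (forall j, j \notin T -> z 0 j = z' 0 j) -> V z -> V z')] &
        forall q, chart_dom c q -> U (chart_map c q) ->
          S q <-> forall j, j \in T -> chart_map c q 0 j = sh (chart_map c q) 0 j]) ->
  is_submanifold A d S.
Proof.
move=> ledm charts; split=> // p Sp.
have [c [U [V [T [sh [[Ac imc cp Up] [cT oV oU sUV] dsh [shT shE VE] Sc]]]]]] := charts p Sp.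
have [s sT] := perm_to_tail cT ledm.
pose f z := col_perm s (z - sh z).
pose g w := let y := col_perm s^-1%g w in y + sh y.
(* [f] and [g] do not alter the coordinates outside T, on which sh depends. *)
have agrf z j : j \notin T -> (z - sh z) 0 j = z 0 j.
  by move=> jT; rewrite !mxE shT // subr0.
have agrg z j : j \notin T -> (z + sh z) 0 j = z 0 j.
  by move=> jT; rewrite !mxE shT // addr0.
have fK z : g (f z) = z.
  rewrite /g /f -col_permM mulVg col_perm1.
  by rewrite (shE _ z) ?subrK // => j jT; rewrite agrf.
have gK w : f (g w) = w.
  rewrite /g /f; set y := col_perm _ w.
  rewrite (shE (y + sh y) y) ?addrK; last by move=> j jT; rewrite agrg.
  by rewrite /y -col_permM mulgV col_perm1.
have dperm (t : {perm 'I_m}) (z : 'rV[C]_m) : differentiable (fun y : 'rV[C]_m => col_perm t y) z.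
  apply: differentiable_mx => a b; under eq_fun do rewrite mxE.
  exact: differentiable_coord.
have df z : V z -> differentiable f z.
  move=> Vz; apply: (@differentiable_comp _ _ _ _ (fun y => y - sh y) (col_perm s)).
    by apply: differentiableB => //; exact: dsh.
  exact: dperm.
have dg z : V (col_perm s^-1%g z) -> differentiable g z.
  move=> Vz.
  apply: (@differentiable_comp _ _ _ _ (col_perm s^-1%g) (fun y => y + sh y)).
    exact: dperm.
  by apply: differentiableD => //; exact: dsh.
have Vg w : V (g w) <-> V (col_perm s^-1%g w).
  by split; apply: VE => j jT; rewrite agrg.
have fU : f @` U = g @^-1` U.
  apply/seteqP; split=> [_ [z Uz <-]|w Uw] /=; first by rewrite fK.
  by exists (g w).
have oW : open (f @` U).
  rewrite fU; apply: open_comp => // w; rewrite inE /= => /sUV/Vg Vw.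
  exact: differentiable_continuous (dg w Vw).
have sUc : U `<=` chart_map c @` chart_dom c by rewrite imc.
have dgU z : (f @` U) z -> differentiable g z.
  by rewrite fU => /sUV/Vg/dg.
exists (@change_chart C M m c U f g sUc (fun z _ => fK z) oW); split.
- move=> c' Ac'; apply: change_chart_compatible => //.
  + by move=> z /sUV/df.
  + exact: (atlas_compat Ac' Ac).
- by split.
- move=> q [cq Uq]; rewrite Sc //= /f; split=> H j.
    rewrite -sT => jT; rewrite mxE; have := H _ jT => E.
    by rewrite mxE E mxE subrr.
  move=> jT; have := H (s^-1%g j); rewrite -sT permKV => /(_ jT).
  by rewrite !mxE permKV => /eqP; rewrite subr_eq0 => /eqP.
Qed.

End Shear.

(** * Choice of pivots *)
Section Pivots.
Local Open Scope ring_scope.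

Lemma colsub_unit (F : fieldType) (r n : nat) (B : 'M[F]_(r, n)) : \rank B = r ->
  exists2 g : 'I_r -> 'I_n, injective g & colsub g B \in unitmx.
Proof.
move=> rB; have fB : row_full B^T by rewrite /row_full mxrank_tr rB.
exists (fullrankfun fB); first exact: fullrankfun_inj.
rewrite -unitmx_tr (_ : _^T = rowsub (fullrankfun fB) B^T) ?fullrowsub_unit //.
by apply/matrixP => a b; rewrite !mxE.
Qed.

Lemma rowsub_base (F : fieldType) (r p n : nat) (B : 'M[F]_(p, n)) : \rank B = r ->
  exists2 f : 'I_r -> 'I_p, injective f & (rowsub f B :=: B)%MS.
Proof.
by move=> <-; exists (maxrankfun B); [exact: maxrankfun_inj | exact: eq_maxrowsub].
Qed.

(** Any injective choice of k coordinates gives the two inverse bijections that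
    index an affine chart of the Grassmannian. *)
Lemma split_coordinates (k n : nat) (f : 'I_k -> 'I_n) : injective f ->
  exists (e : 'I_k + 'I_(n - k) -> 'I_n) (e' : 'I_n -> 'I_k + 'I_(n - k)),
    [/\ cancel e e', cancel e' e & forall a, e (inl a) = f a].
Proof.
move=> f_inj.
have lekn : (k <= n)%N by have := leq_card f f_inj; rewrite !card_ord.
have cardJ : #|~: [set f a | a : 'I_k]| = (n - k)%N.
  by rewrite cardsCs finset.setCK card_imset // !card_ord.
pose g (b : 'I_(n - k)) : 'I_n := enum_val (cast_ord (esym cardJ) b).
have gJ b a : g b != f a.
  have : g b \in ~: [set f a | a : 'I_k] by exact: enum_valP.
  by rewrite inE; apply: contraNneq => ->; rewrite imset_f.
pose e (s : 'I_k + 'I_(n - k)) := match s with inl a => f a | inr b => g b end.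
have e_inj : injective e.
  move=> [a|b] [a'|b'] /= E.
  - by rewrite (f_inj _ _ E).
  - by have := gJ b' a; rewrite E eqxx.
  - by have := gJ b a'; rewrite E eqxx.
  - by rewrite (cast_ord_inj (enum_val_inj E)).
have [e' eK e'K] : bijective e.
  by apply: inj_card_bij; rewrite // card_sum !card_ord subnKC.
by exists e, e'.
Qed.

End Pivots.

(** * The rank condition in affine coordinates *)
Section RankStratum.
Local Open Scope ring_scope.
Variables (C : numClosedFieldType) (k n h i : nat).
Variables (e : 'I_h -> 'I_k + 'I_(n - k) -> 'I_n) (e' : 'I_h -> 'I_n -> 'I_k + 'I_(n - k)).
Hypotheses (eK : forall a, cancel (e a) (e' a)) (e'K : forall a, cancel (e' a) (e a)).
Variables (f : 'I_i -> 'I_h * 'I_k) (g : 'I_i -> 'I_n).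
Hypotheses (f_inj : injective f) (g_inj : injective g).
Hypothesis (pivots_g : forall a b, e a (inl b) \in codom g).

Local Notation N := (h * (k * (n - k)))%N.
Implicit Types z : 'rV[C]_N.

Definition frames z (a : 'I_h) : 'M[C]_(k, n) :=
  frame (e' a) (vec_mx (row a (vec_mx z))).

Definition selected_rows z : 'M[C]_(i, n) :=
  \matrix_(r, y) frames z (f r).1 (f r).2 y.

Definition selected_minor z : 'M[C]_i := colsub g (selected_rows z).

(** When the minor is invertible, the only matrix whose rows lie in the span of
    the selected rows and that agrees with the frame in the columns of [g]. *)
Definition interpolant z a : 'M[C]_(k, n) :=
  colsub g (frames z a) *m invmx (selected_minor z) *m selected_rows z.

(** The coordinate (a, b, c) is the entry of the stacked frames in row (a, b) and
    column e a (inr c). Entries in a selected row or column can vary freely in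
    the stratum; they determine all the others. *)
Definition dependent a b c := ((a, b) \notin codom f) && (e a (inr c) \notin codom g).

(** Encoded as the support of a boolean vector to reuse the flattening of the
    coordinates by [mxvec]. *)
Definition dependent_set : {set 'I_N} :=
  [set j | (mxvec (\matrix_a mxvec (\matrix_(b, c) dependent a b c)) : 'rV[bool]_N) 0 j]%SET.

Definition shear z : 'rV[C]_N :=
  mxvec (\matrix_a mxvec (\matrix_(b, c)
    if dependent a b c then interpolant z a b (e a (inr c)) else 0)).

Lemma mem_dependent_set a b c :
  (mxvec_index a (mxvec_index b c) \in dependent_set) = dependent a b c.
Proof. by rewrite inE !mxvecE !mxE !mxvecE !mxE. Qed.

Lemma shearE z a b c : shear z 0 (mxvec_index a (mxvec_index b c)) =
  if dependent a b c then interpolant z a b (e a (inr c)) else 0.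
Proof. by rewrite !mxvecE !mxE !mxvecE !mxE. Qed.

Lemma frames_inl z a b b' : frames z a b (e a (inl b')) = (b == b')%:R.
Proof. by rewrite mxE eK. Qed.

Lemma frames_inr z a b c :
  frames z a b (e a (inr c)) = z 0 (mxvec_index a (mxvec_index b c)).
Proof. by rewrite mxE eK !mxE. Qed.

Lemma shear_support z j : j \notin dependent_set -> shear z 0 j = 0.
Proof.
case/mxvec_indexP: j => a j; case/mxvec_indexP: j => b c.
by rewrite mem_dependent_set shearE => /negbTE ->.
Qed.

(** Selected rows and the columns of [g] contain no dependent entry, and the
    shear is computed from them alone: it does not involve the coordinates that
    it modifies, as required for a graph. *)
Section Locality.
Variables z z' : 'rV[C]_N.
Hypothesis zz' : forall j, j \notin dependent_set -> z 0 j = z' 0 j.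

Lemma frames_local a b y : ((a, b) \in codom f) || (y \in codom g) ->
  frames z a b y = frames z' a b y.
Proof.
rewrite -[y](e'K a); case: (e' a y) => [b'|c]; first by rewrite !frames_inl.
rewrite !frames_inr => H; apply: zz'.
by rewrite mem_dependent_set /dependent -negb_or negbK.
Qed.

Lemma selected_rows_local : selected_rows z = selected_rows z'.
Proof.
apply/matrixP => r y; rewrite !mxE -/(frames z (f r).1) -/(frames z' (f r).1).
have := @frames_local (f r).1 (f r).2 y; rewrite -surjective_pairing codom_f.
by rewrite !mxE => ->.
Qed.

Lemma selected_minor_local : selected_minor z = selected_minor z'.
Proof. by rewrite /selected_minor selected_rows_local. Qed.

Lemma shear_local : shear z = shear z'.
Proof.
have fr a : colsub g (frames z a) = colsub g (frames z' a).
  apply/matrixP => b r; rewrite 2![colsub _ _ _ _]mxE.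
  by apply: frames_local; rewrite codom_f orbT.
by rewrite /shear /interpolant selected_minor_local selected_rows_local;
  under eq_mx do under eq_mx do rewrite fr.
Qed.

End Locality.

(** The pivots of H_a are among the columns of [g], so all the n - i columns
    outside the image of [g] are non-pivot columns, for every a. *)
Lemma card_dependent_set : #|dependent_set| = ((h * k - i) * (n - i))%N.
Proof.
pose D := [set x : 'I_h * 'I_k * 'I_(n - k) | dependent x.1.1 x.1.2 x.2]%SET.
(* The two indexings of the dependent entries: by coordinates of the chart, and
   by positions in the stacked frames, where they form a rectangle. *)
pose j0 (x : 'I_h * 'I_k * 'I_(n - k)) : 'I_N :=
  mxvec_index x.1.1 (mxvec_index x.1.2 x.2).
pose y0 (x : 'I_h * 'I_k * 'I_(n - k)) := (x.1, e x.1.1 (inr x.2)).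
have mi_inj p q a b a' b' : @mxvec_index p q a b = mxvec_index a' b' -> (a, b) = (a', b').
  by move=> E; have [G GK _] := curry_mxvec_bij p q;
    rewrite -[LHS]GK ?inE //= E -[RHS]GK ?inE.
have j0_inj : injective j0.
  move=> [[a b] c] [[a' b'] c'] /mi_inj E.
  by have [-> ->] := mi_inj _ _ _ _ _ _ (congr1 snd E); have /= -> := congr1 fst E.
have y0_inj : injective y0.
  move=> [[a b] c] [[a' b'] c'] [/= <- <- /(congr1 (e' a))].
  by rewrite !eK => -[->].
have -> : dependent_set = j0 @: D.
  apply/setP => j; apply/idP/imsetP => [|[x xD ->]].
    case/mxvec_indexP: j => a j; case/mxvec_indexP: j => b c.
    by rewrite mem_dependent_set => H; exists (a, b, c); rewrite // inE.
  by rewrite mem_dependent_set; move: xD; rewrite inE.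
rewrite card_imset // -(card_imset _ y0_inj).
have -> : y0 @: D = finset.setX (~: [set x in codom f]%SET) (~: [set y in codom g]%SET).
  apply/setP => -[[a b] y]; rewrite !inE /=; apply/imsetP/andP => /=.
    by move=> [[[a' b'] c]]; rewrite !inE /= => /andP[Hf Hg] [-> -> ->].
  move=> [Hf Hg]; case E: (e' a y) => [b'|c].
    by move: Hg; rewrite -[y](e'K a) E pivots_g.
  have Ey : y = e a (inr c) by rewrite -E e'K.
  by exists (a, b, c); rewrite ?Ey // inE /dependent /= Hf -Ey.
have cC (X : finType) (B : {set X}) : #|~: B| = (#|X| - #|B|)%N.
  by rewrite cardsCs finset.setCK.
by rewrite cardsX !cC !cardsE !card_codom // card_prod !card_ord.
Qed.

Lemma differentiable_frames a z : differentiable (fun y => frames y a) z.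
Proof.
apply: differentiable_mx => b y; rewrite -[y](e'K a); case: (e' a y) => c.
  by under eq_fun do rewrite frames_inl; exact: differentiable_cst.
by under eq_fun do rewrite frames_inr; exact: differentiable_coord.
Qed.

Lemma differentiable_selected_rows z : differentiable selected_rows z.
Proof.
apply: differentiable_mx => r y; rewrite /selected_rows.
under eq_fun do rewrite mxE.
apply: differentiable_entry; exact: differentiable_frames.
Qed.

Lemma differentiable_selected_minor z : differentiable selected_minor z.
Proof.
apply: differentiable_mx => r y; rewrite /selected_minor.
under eq_fun do rewrite mxE.
apply: differentiable_entry; exact: differentiable_selected_rows.
Qed.

Lemma differentiable_shear z : selected_minor z \in unitmx -> differentiable shear z.
Proof.
move=> uz; apply: differentiable_mx => l j; rewrite (ord1 l).
case/mxvec_indexP: j => a j; case/mxvec_indexP: j => b c.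
under eq_fun do rewrite shearE.
case: (dependent a b c); last exact: differentiable_cst.
apply: differentiable_entry.
apply: differentiable_mulmx; last exact: differentiable_selected_rows.
apply: differentiable_mulmx.
  apply: differentiable_mx => b' r; under eq_fun do rewrite mxE.
  by apply: differentiable_entry; exact: differentiable_frames.
by apply: differentiable_invmx => //; exact: differentiable_selected_minor.
Qed.

Lemma open_selected_minor : open [set z | selected_minor z \in unitmx].
Proof.
rewrite (_ : [set z | _] = (fun z => \det (selected_minor z)) @^-1` [set x | x != 0]).
  apply: open_comp; last exact: open_neq0.
  move=> z _; apply: differentiable_continuous; apply: differentiable_det.
  exact: differentiable_selected_minor.
by apply/seteqP; split=> z; rewrite /= unitmxE unitfE.
Qed.

Lemma interpolantP z a : selected_minor z \in unitmx ->
  (frames z a <= selected_rows z)%MS <-> frames z a = interpolant z a.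
Proof.
move=> uz; split=> [/submxP[P E]|->]; last exact: submxMl.
have gP : colsub g (frames z a) = P *m selected_minor z.
  rewrite E; apply/matrixP => b r; rewrite !mxE.
  by apply: eq_bigr => s _; rewrite !mxE.
by rewrite /interpolant gP mulmxK.
Qed.

(** A frame and its interpolant agree automatically in the columns of [g], by
    construction, and in the selected rows, which are their own interpolants;
    what remains are the dependent entries. *)
Lemma frames_eq_interpolant z : selected_minor z \in unitmx ->
  (forall a, frames z a = interpolant z a) <->
  (forall j, j \in dependent_set -> z 0 j = shear z 0 j).
Proof.
move=> uz; split=> [E j|E a].
  case/mxvec_indexP: j => a j; case/mxvec_indexP: j => b c.
  by rewrite mem_dependent_set shearE => H; rewrite H -E frames_inr.
apply/matrixP => b y.
have [/codomP[r ->]|yg] := boolP (y \in codom g).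
  have : colsub g (frames z a) = colsub g (interpolant z a).
    rewrite /interpolant; transitivity
      (colsub g (frames z a) *m invmx (selected_minor z) *m selected_minor z).
      by rewrite mulmxKV.
    apply/matrixP => b' r'; rewrite [LHS]mxE [RHS]mxE [RHS]mxE.
    by apply: eq_bigr => s _; congr (_ * _); rewrite mxE.
  by move/matrixP/(_ b r); rewrite [LHS]mxE [RHS]mxE.
have [/codomP[r abr]|abf] := boolP ((a, b) \in codom f).
  have sel : row b (frames z a) = row r (selected_rows z).
    by apply/rowP => x; rewrite mxE [RHS]mxE [RHS]mxE -abr.
  have selg : row b (colsub g (frames z a)) = row r (selected_minor z).
    by apply/rowP => x; move/rowP/(_ (g x)): sel; rewrite !mxE.
  have : row b (interpolant z a) = row b (frames z a).
    rewrite /interpolant !row_mul selg sel.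
    by rewrite -row_mul mulmxV // row1 -rowE.
  by move/rowP/(_ y); rewrite mxE [RHS]mxE => ->.
case Ey: (e' a y) => [b'|c].
  by move: yg; rewrite -[y](e'K a) Ey pivots_g.
have {}Ey : y = e a (inr c) by rewrite -Ey e'K.
have dep : dependent a b c by rewrite /dependent abf -Ey.
by rewrite Ey frames_inr E ?mem_dependent_set // shearE dep.
Qed.

(** The selected rows span an i-dimensional subspace of the sum, so the sum
    has dimension i if and only if it is contained in their span. *)
Lemma dim_sum_frames z : selected_minor z \in unitmx ->
  \dim (\sum_(a < h) rowspan (frames z a))%VS = i <->
  forall j, j \in dependent_set -> z 0 j = shear z 0 j.
Proof.
move=> uz; rewrite -frames_eq_interpolant //.
have sub a : (rowspan (frames z a) <= rowspan (selected_rows z))%VS <->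
    frames z a = interpolant z a.
  rewrite -interpolantP //; split=> [/subvP s|s].
    by apply/row_subP => b; rewrite -mem_rowspan s // mem_rowspan row_sub.
  by apply/subvP => v; rewrite !mem_rowspan => /submx_trans; apply.
have rk : \dim (rowspan (selected_rows z)) = i.
  rewrite dim_rowspan; apply/eqP; rewrite eqn_leq rank_leq_row /=.
  rewrite -{1}(mxrank_unit uz) /selected_minor.
  rewrite (_ : colsub g _ = selected_rows z *m colsub g 1%:M) ?mxrankM_maxl //.
  by rewrite mulmx_colsub mulmx1.
have ge : (rowspan (selected_rows z) <= \sum_(a < h) rowspan (frames z a))%VS.
  apply/subvP => v; rewrite mem_rowspan => /submxP[P ->].
  rewrite mulmx_sum_row; apply: rpred_sum => r _; apply: rpredZ.
  apply: (subvP (sumv_sup (f r).1 _ (subvv _))) => //.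
  rewrite mem_rowspan (_ : row r _ = row (f r).2 (frames z (f r).1)) ?row_sub //.
  by apply/rowP => y; rewrite !mxE.
split=> [E a|E].
  apply/sub; have /eqP -> : rowspan (selected_rows z) == (\sum_(a < h) rowspan (frames z a))%VS.
    by rewrite eqEdim ge E rk leqnn.
  by apply: (sumv_sup a).
rewrite -rk; congr (\dim _); apply/eqP; rewrite eqEsubv ge andbT.
by apply/subv_sumP => a _; apply/sub.
Qed.

(** If the first frame is P times the second, comparing the pivot columns of the
    second identifies P; equality of subspaces becomes a polynomial equation. *)
Lemma eq_rowspan_frames z a b : rowspan (frames z a) = rowspan (frames z b) <->
  frames z a - pivot (e b) (frames z a) *m frames z b = 0.
Proof.
have [pb pa] : pivot (e b) (frames z b) = 1%:M /\ pivot (e a) (frames z a) = 1%:M.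
  by split; apply: pivot_frame.
split=> [/rowspan_eq E|/eqP].
  have /submxP[P EP] : (frames z a <= frames z b)%MS by rewrite E.
  by rewrite EP pivotM pb mulmx1 subrr.
rewrite subr_eq0 => /eqP E; apply/eqP; rewrite eqEdim !dim_rowspan.
rewrite (rank_frame (eK a)) (rank_frame (eK b)) leqnn andbT.
apply/subvP => v; rewrite !mem_rowspan => /submx_trans; apply.
by rewrite E submxMl.
Qed.

Definition distinct_frames : set 'rV[C]_N :=
  [set z | forall a b, a <> b -> rowspan (frames z a) <> rowspan (frames z b)].

Lemma open_distinct_frames : open distinct_frames.
Proof.
pose G a b z := frames z a - pivot (e b) (frames z a) *m frames z b.
have oG a b : open [set z | G a b z != 0].
  rewrite (_ : [set z | _] = G a b @^-1` (~` [set 0])); last first.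
    by apply/seteqP; split=> z /= /eqP.
  apply: open_comp.
    move=> z _; apply: differentiable_continuous; apply: differentiableB.
      exact: differentiable_frames.
    apply: differentiable_mulmx; last exact: differentiable_frames.
    apply: differentiable_mx => l r; under eq_fun do rewrite mxE.
    by apply: differentiable_entry; exact: differentiable_frames.
  rewrite openC; apply: accessible_closed_set1; apply: hausdorff_accessible.
  exact: norm_hausdorff.
rewrite openE => z zD.
suff : \forall y \near z, forall a b, a <> b -> rowspan (frames y a) <> rowspan (frames y b).
  by [].
apply: (@filter_forall _ _ (fun a y => forall b, a <> b ->
  rowspan (frames y a) <> rowspan (frames y b)) (nbhs z)) => a.
apply: (@filter_forall _ _ (fun b y => a <> b ->
  rowspan (frames y a) <> rowspan (frames y b)) (nbhs z)) => b.
have [ab|ab] := pselect (a = b); first by apply: nearW.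
have : \forall y \near z, G a b y != 0.
  apply: open_nbhs_nbhs; split; first exact: oG.
  by apply/eqP => /eq_rowspan_frames; exact: zD.
by apply: filterS => y /eqP Gy _ /eq_rowspan_frames.
Qed.

End RankStratum.

(** * The strata of the configuration space *)
Section Configuration.
Local Open Scope ring_scope.
Variables (C : numClosedFieldType) (k n h i : nat).

(** Since H_a is contained in W, its basis matrix is P *m BW with P of rank k;
    keeping only the columns of [g] multiplies P by an invertible matrix, so k
    independent columns remain among them. *)
Lemma adapted_pivots (H : 'I_h -> Gr C k n) :
  \dim (\sum_(a < h) val (H a))%VS = i ->
  exists (e : 'I_h -> 'I_k + 'I_(n - k) -> 'I_n) (e' : 'I_h -> 'I_n -> 'I_k + 'I_(n - k))
      (f : 'I_i -> 'I_h * 'I_k) (g : 'I_i -> 'I_n),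
    [/\ [/\ forall a, cancel (e a) (e' a) & forall a, cancel (e' a) (e a)],
        [/\ injective f & injective g],
        forall a b, e a (inl b) \in codom g,
        forall a, affine_dom (e a) (H a) &
        forall z, (forall a, val (H a) = rowspan (frames e' z a)) ->
          selected_minor e' f g z \in unitmx].
Proof.
set W := (\sum_(a < h) _)%VS => dW.
pose BW : 'M[C]_(i, n) := \matrix_(a < i) (vbasis W)`_a.
have BWE : rowspan BW = W.
  rewrite -[RHS](span_basis (vbasisP W)); congr span; apply: (@eq_from_nth _ 0).
    by rewrite !size_tuple dW.
  move=> j; rewrite size_tuple => ji.
  by rewrite -[j]/(val (Ordinal ji)) nth_mktuple rowK.
have rBW : \rank BW = i by rewrite -dim_rowspan BWE.
have [g g_inj gBW] := colsub_unit rBW.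
have colsubM p (P : 'M[C]_(p, i)) : colsub g (P *m BW) = P *m colsub g BW.
  by rewrite mulmx_colsub.
have /choice[f1 f1P] : forall a, exists f1 : 'I_k -> 'I_i,
    injective f1 /\ colsub f1 (colsub g (basis_mx (H a))) \in unitmx.
  move=> a; have /submxP[P EP] : (basis_mx (H a) <= BW)%MS.
    apply/row_subP => b; rewrite -mem_rowspan BWE.
    apply: (subvP (sumv_sup a _ (subvv _))) => //.
    by rewrite -rowspan_basis_mx mem_rowspan row_sub.
  have rk : \rank (colsub g (basis_mx (H a))) = k.
    rewrite EP colsubM mxrankMfree ?row_free_unit //.
    apply/eqP; rewrite eqn_leq rank_leq_row /= -{1}(rank_basis_mx (H a)) EP.
    exact: mxrankM_maxl.
  by have [f1 ? ?] := colsub_unit rk; exists f1.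
have /choice[ee eeP] : forall a, exists ee :
    ('I_k + 'I_(n - k) -> 'I_n) * ('I_n -> 'I_k + 'I_(n - k)),
    [/\ cancel ee.1 ee.2, cancel ee.2 ee.1 & forall b, ee.1 (inl b) = g (f1 a b)].
  move=> a; have [f1_inj _] := f1P a.
  have [e [e' [eK e'K el]]] := split_coordinates (inj_comp g_inj f1_inj).
  by exists (e, e').
pose e a := (ee a).1; pose e' a := (ee a).2.
have eK a : cancel (e a) (e' a) by have [? ? ?] := eeP a.
have e'K a : cancel (e' a) (e a) by have [? ? ?] := eeP a.
have el a b : e a (inl b) = g (f1 a b) by have [_ _] := eeP a; apply.
pose z0 : 'rV[C]_(h * (k * (n - k))) := mxvec (\matrix_a affine_map (e a) (H a)).
(* The frames of all the H_a, stacked. *)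
pose Q : 'M[C]_(#|{: 'I_h * 'I_k}|, n) :=
  \matrix_(l, y) frames e' z0 (enum_val l).1 (enum_val l).2 y.
have affH a : affine_dom (e a) (H a).
  have [_] := f1P a; rewrite /affine_dom /=; congr (_ \in unitmx).
  by apply/matrixP => b b'; rewrite !mxE el.
have z0H a : val (H a) = rowspan (frames e' z0 a).
  rewrite -[in LHS](affine_mapK (eK a) (e'K a) (affH a)) /=.
  have z0a : row a (vec_mx z0) = affine_map (e a) (H a) by rewrite mxvecK rowK.
  by rewrite /frames z0a.
have QW : rowspan Q = W.
  apply/eqP; rewrite eqEsubv; apply/andP; split.
    apply/subvP => v; rewrite mem_rowspan => /submxP[P ->].
    rewrite mulmx_sum_row; apply: rpred_sum => l _; apply: rpredZ.
    apply: (subvP (sumv_sup (enum_val l).1 _ (subvv _))) => //.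
    rewrite z0H mem_rowspan.
    rewrite (_ : row l _ = row (enum_val l).2 (frames e' z0 (enum_val l).1)) ?row_sub //.
    by apply/rowP => y; rewrite !mxE.
  apply/subv_sumP => a _; rewrite z0H; apply/subvP => v; rewrite !mem_rowspan.
  move/submx_trans; apply; apply/row_subP => b.
  rewrite (_ : row b _ = row (enum_rank (a, b)) Q) ?row_sub //.
  by apply/rowP => y; rewrite [RHS]mxE [RHS]mxE enum_rankK mxE.
have rQ : \rank Q = i by rewrite -dim_rowspan QW.
have [f0 f0_inj f0Q] := rowsub_base rQ.
have rf0 : \rank (rowsub f0 Q) = i by rewrite f0Q.
pose f r := enum_val (f0 r).
exists e, e', f, g; split=> //.
- by split=> // r r' /enum_val_inj/f0_inj.
- by move=> a b; rewrite el codom_f.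
move=> z zH.
(* A subspace has at most one frame, hence z has the frames of z0. *)
have -> : selected_minor e' f g z = colsub g (rowsub f0 Q).
  have fr a : frames e' z a = frames e' z0 a.
    have := rowspan_eq (etrans (esym (zH a)) (z0H a)) => E.
    have /submxP[P EP] : (frames e' z a <= frames e' z0 a)%MS by rewrite E.
    have := congr1 (fun B => pivot (e a) B) EP.
    by rewrite pivotM !(pivot_frame (eK a)) mulmx1 => P1; rewrite EP -P1 mul1mx.
  by apply/matrixP => r y; rewrite [LHS]mxE [LHS]mxE fr !mxE.
have /submxP[P EP] : (rowsub f0 Q <= BW)%MS.
  by rewrite f0Q; apply/row_subP => l; rewrite -mem_rowspan BWE -QW mem_rowspan row_sub.
rewrite EP colsubM unitmx_mul gBW andbT -row_free_unit /row_free eqn_leq rank_leq_row /=.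
by rewrite -{1}rf0 EP mxrankM_maxl.
Qed.

Lemma ith_configuration_space_submanifold :
  (0 < h)%N -> ith_configuration_space C h i k n !=set0 ->
  is_submanifold (prod_atlas h (Gr_atlas C k n))
    (i * (n - i) + h * k * (i - k))%N (ith_configuration_space C h i k n).
Proof.
move=> h0 [H0 [_ dH0]].
have leki : (k <= i)%N.
  have a0 : 'I_h by exact: Ordinal h0.
  rewrite -(eqP (valP (H0 a0))) -dH0; apply: dimvS; exact: (sumv_sup a0).
have lein : (i <= n)%N.
  by rewrite -dH0 (leq_trans (dimvS (subvf _))) // dimvf /dim /= mul1n.
have leihk : (i <= h * k)%N.
  have [e [e' [f [g [_ [f_inj _] _ _ _]]]]] := adapted_pivots dH0.
  by have := leq_card f f_inj; rewrite card_prod !card_ord.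
(* The number of equations is the codimension. *)
have cN : ((h * k - i) * (n - i) =
    h * (k * (n - k)) - (i * (n - i) + h * k * (i - k)))%N.
  have -> : (h * (k * (n - k)) = h * k * (n - i) + h * k * (i - k))%N.
    by rewrite mulnA -mulnDr addnBA // subnK.
  by rewrite subnDr mulnBl.
apply: is_submanifold_shear.
  rewrite mulnA (_ : (n - k = (n - i) + (i - k))%N); last by rewrite addnBA // subnK.
  by rewrite mulnDr leq_add2r leq_mul2r leihk orbT.
move=> H [Hdist dH].
have [e [e' [f [g [[eK e'K] [f_inj g_inj] eg affH minorH]]]]] := adapted_pivots dH.
pose c := prod_chart (fun a => affine_chart C (eK a) (e'K a)).
have valE q a : chart_dom c q -> val (q a) = rowspan (frames e' (chart_map c q) a).
  move=> cq; rewrite -[in LHS](chart_mapK cq) /= /prod_inv /=.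
  by rewrite /frames.
pose V := [set z : 'rV[C]_(h * (k * (n - k))) | selected_minor e' f g z \in unitmx].
pose U := V `&` distinct_frames (C := C) e'.
have Uconf q : chart_dom c q ->
    distinct_frames (C := C) e' (chart_map c q) <-> configuration_space q.
  move=> cq; split=> D a b ab.
    by move=> /(congr1 val); rewrite !valE //; exact: D.
  by rewrite -!valE // => /val_inj; exact: D.
exists c, U, V, (dependent_set e f g), (shear e e' f g); split.
- split.
  + by exists (fun a => affine_chart C (eK a) (e'K a)) => // a;
      exists (e a), (e' a), (eK a), (e'K a).
  + apply/seteqP; split=> // z _.
    exists (prod_inv (fun a => affine_chart C (eK a) (e'K a)) z).
      by move=> a; exact: affine_invD.
    rewrite /= /prod_map -[RHS]vec_mxK; congr mxvec; apply/row_matrixP => a.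
    by rewrite rowK; exact: affine_invK.
  + by [].
  + split; last by apply/Uconf.
    by apply: minorH => a; apply: valE.
- split.
  + by rewrite (card_dependent_set eK e'K f_inj g_inj eg).
  + exact: open_selected_minor eK e'K _ _.
  + apply: openI; first exact: open_selected_minor eK e'K _ _.
    exact: open_distinct_frames eK e'K.
  + exact: subIsetl.
- by move=> z; exact: differentiable_shear.
- split.
  + exact: shear_support.
  + by move=> z z'; exact: shear_local.
  + move=> z z' zz'; rewrite /V /=.
    by rewrite (selected_minor_local eK e'K zz').
- move=> q cq [Vq /(Uconf q cq) qdist].
  rewrite -(dim_sum_frames eK e'K eg Vq) -[ith_configuration_space _ _ _ _ _ q]/(_ /\ _).
  under eq_bigr do rewrite valE //.
  by split=> [[]|].
Qed.

End Configuration.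
Theorem theorem2p1 (R : realType) (n k h i : nat)
    (hk : (0 < k)%N) (hkn : (k < n)%N) (hh : (2 <= h)%N)
    (hF : ith_configuration_space (complexes R) h i k n !=set0) :
  is_submanifold (prod_atlas h (Gr_atlas (complexes R) k n))
    (i * (n - i) + h * k * (i - k))%N
    (ith_configuration_space (complexes R) h i k n).
Proof. exact: ith_configuration_space_submanifold (ltnW hh) hF. Qed.
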